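(* Let $P\in\mathbb{R}[X]$ be a polynomial with non-negative coefficients and degree $n\ge 1$. Consider the properties: (P1) $P$ is real-rooted; (P2) $P(x)P''(x)+\left(\frac1n-1\right)P'(x)^2\le 0$ for all $x\in\mathbb{R}$; (P3) the function $P^{1/n}$ is concave on $(0,\infty)$. If $n\le 2$, then (P1), (P2) and (P3) are equivalent. If $n=3$, then (P1) and (P2) are equivalent.
   Context: A real polynomial is real-rooted if all its complex roots are real. *)

(* Defs.v *)
From HB Require Import structures.
From mathcomp Require Import all_boot all_order all_algebra.
From mathcomp Require Import all_classical all_reals all_analysis.
From mathcomp Require Import complex.
Set Implicit Arguments.
Unset Strict Implicit.
Unset Printing Implicit Defensive.
Import Order.TTheory GRing.Theory Num.Theory.
Local Open Scope classical_set_scope.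
Local Open Scope ring_scope.

Definition real_rooted (R : rcfType) (P : {poly R}) : Prop :=
  forall z : R[i]%C, root (map_poly (real_complex R) P) z -> complex.Im z = 0.

Local Open Scope convex_scope.

(* Same shape as the library's [convex_function], with the inequality
   reversed; [x <| t |> y] is t x + (1 - t) y with t in [0, 1]. *)
Definition concave_function (R : numFieldType) (E : lmodType R)
    (E' := convex_lmodType E) (D : set E') (f : E' -> R^o) : Prop :=
  forall t : {i01 R},
    {in D &, forall x y : E', f x <| t |> f y <= f (x <| t |> y)}.

(* Main.v *)
(** For [n = 2], [P P'' - P'^2 / 2] is the constant [- D / 2] with [D] the discriminant of [P], and
    the polar form [B] of [P] satisfies [B(x, y)^2 - P(x) P(y) = D / 4 (x - y)^2]; squaring the
    concavity inequality of [sqrt P] reduces it to [sqrt (P(x) P(y)) <= B(x, y)].  A cubic is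
    [(X - t) Q] with [t] real and [Q] quadratic, and [P P'' - 2/3 P'^2] is
    [- (3 D (x - t)^2 + E(x)^2) / 6] with [D] the discriminant of [Q] and [E] affine: this is
    nonpositive everywhere exactly when [0 <= D], since a zero of [E] differs from [t] unless
    [Q(t) = 0]. *)
Require Import Defs.
From mathcomp Require Import all_boot all_order all_algebra.
From mathcomp Require Import all_classical all_reals all_analysis.
From mathcomp Require Import complex polyrcf ring lra.
Import Order.TTheory GRing.Theory Num.Theory.
Local Open Scope classical_set_scope.
Local Open Scope ring_scope.

Definition quadratic {R : nzRingType} (a b c : R) : {poly R} :=
  a *: 'X^2 + b *: 'X + c%:P.

Lemma horner_quadratic {R : comNzRingType} (a b c x : R) :
  (quadratic a b c).[x] = a * x ^+ 2 + b * x + c.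
Proof. by rewrite /quadratic !hornerE. Qed.

Lemma size3_quadratic {R : nzRingType} (P : {poly R}) :
  size P = 3%N -> P = quadratic P`_2 P`_1 P`_0.
Proof.
move=> sP; apply/polyP => -[|[|[|i]]]; rewrite /quadratic !coefE /=;
  rewrite ?mulr0 ?mulr1 ?addr0 ?add0r //.
by rewrite nth_default ?sP.
Qed.

Lemma deriv_quadratic {R : nzRingType} (a b c : R) :
  (quadratic a b c)^`() = (a *+ 2) *: 'X + b%:P.
Proof.
by rewrite /quadratic !poly.derivE alg_polyC addr0 expr1 -scaler_nat scalerA mulr_natr.
Qed.

Lemma real_rooted_mul {R : rcfType} (P Q : {poly R}) :
  real_rooted (P * Q) <-> real_rooted P /\ real_rooted Q.
Proof.
split=> [h|[hP hQ] z].
  by split=> z rz; apply: h; rewrite rmorphM /= rootM rz ?orbT.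
by rewrite rmorphM /= rootM => /orP[/hP|/hQ].
Qed.

Lemma real_rooted_XsubC {R : rcfType} (t : R) : real_rooted ('X - t%:P).
Proof. by move=> z; rewrite map_polyXsubC root_XsubC => /eqP->. Qed.

Lemma real_rooted_linear {R : rcfType} (P : {poly R}) :
  size P = 2%N -> real_rooted P.
Proof.
move=> sP [x y].
have -> : P = P`_1 *: 'X + (P`_0)%:P.
  apply/polyP => -[|[|i]]; rewrite !coefE /= ?mulr0 ?mulr1 ?addr0 ?add0r //.
  by rewrite nth_default ?sP.
rewrite /root rmorphD /= map_polyZ /= map_polyX map_polyC /= !hornerE; simpc.
rewrite eq_complex /= mulf_eq0 => /andP[_ /orP[|/eqP//]].
by rewrite -[1%N]/(2.-1) -sP -lead_coefE lead_coef_eq0 -size_poly_eq0 sP.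
Qed.

(** The two conjuncts are the vanishing of the real and the imaginary part. *)
Lemma root_quadraticC {R : rcfType} (a b c x y : R) :
  root (map_poly (real_complex R) (quadratic a b c)) (x +i* y)%C =
  (a * (x ^+ 2 - y ^+ 2) + b * x + c == 0) && (y * (2 * a * x + b) == 0).
Proof.
rewrite /root /quadratic !rmorphD /= !map_polyZ /= map_polyXn map_polyX map_polyC /=.
rewrite !hornerE expr2; simpc; rewrite eq_complex /=.
by congr (_ && _); apply/eqP/eqP; lra.
Qed.

Lemma real_rooted_quadratic {R : rcfType} (a b c : R) : a != 0 ->
  real_rooted (quadratic a b c) <-> 0 <= b ^+ 2 - 4 * a * c.
Proof.
move=> a0; split=> [rr|D0 [x y]].
  rewrite leNgt; apply/negP => D_lt0.
  have s0 : 0 < 4 * a * c - b ^+ 2 by lra.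
  (* If [D < 0], this is the imaginary part of the root [(- b + i sqrt (- D)) / (2 a)]. *)
  pose y := Num.sqrt (4 * a * c - b ^+ 2) / (2 * a).
  have y0 : y != 0.
    by rewrite mulf_neq0 ?invr_eq0 ?mulf_neq0 ?pnatr_eq0// gt_eqF ?sqrtr_gt0.
  have y2 : y ^+ 2 = (4 * a * c - b ^+ 2) / (2 * a) ^+ 2.
    by rewrite /y exprMn sqr_sqrtr ?ltW// exprVn.
  have /eqP : y = 0.
    apply: (rr (- b / (2 * a) +i* y)%C).
    by rewrite root_quadraticC y2; apply/andP; split; apply/eqP; field.
  by rewrite (negPf y0).
rewrite root_quadraticC => /andP[/eqP re0 /=].
rewrite mulf_eq0 => /orP[/eqP//|/eqP bE].
(* A nonreal root has [x = - b / (2 a)]; eliminating [b] and [c] leaves minus a square. *)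
have eqD : b ^+ 2 - 4 * a * c = - (2 * a * y) ^+ 2.
  have -> : b = - 2 * a * x by lra.
  have -> : c = - (a * (x ^+ 2 - y ^+ 2) + b * x) by lra.
  have -> : b = - 2 * a * x by lra.
  ring.
move: D0; rewrite eqD oppr_ge0 => h.
have /eqP : (2 * a * y) ^+ 2 = 0 by apply/eqP; rewrite eq_le h sqr_ge0.
by rewrite sqrf_eq0 !mulf_eq0 pnatr_eq0 (negPf a0) => /eqP.
Qed.

Lemma quadratic_P2 {R : realFieldType} (a b c : R) (P := quadratic a b c) x :
  P.[x] * P^`(2).[x] + (2%:R^-1 - 1) * P^`().[x] ^+ 2 =
  - (b ^+ 2 - 4 * a * c) / 2.
Proof.
rewrite /P derivSn derivn1 !deriv_quadratic horner_quadratic !poly.derivE !hornerE.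
by rewrite /=; field.
Qed.

(* If [r], [s] are the roots of the quadratic factor, then the right-hand side is [- a^2 / 3] times
   [(r - s)^2 (x - t)^2 + (r - t)^2 (x - s)^2 + (s - t)^2 (x - r)^2]. *)
Lemma cubic_P2 {R : realFieldType} (a b c t : R)
    (P := ('X - t%:P) * quadratic a b c) x :
  P.[x] * P^`(2).[x] + (3%:R^-1 - 1) * P^`().[x] ^+ 2 =
  - (3 * (b ^+ 2 - 4 * a * c) * (x - t) ^+ 2
     + ((b + 2 * a * t) * x + (2 * c + t * b)) ^+ 2) / 6.
Proof.
rewrite /P derivSn derivn1 !(derivM, derivD, deriv_quadratic) !poly.derivE.
by rewrite !hornerE /=; field.
Qed.

Lemma cubic_P2_disc {R : realFieldType} (a b c t : R) : a != 0 ->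
  (forall x, 0 <= 3 * (b ^+ 2 - 4 * a * c) * (x - t) ^+ 2
     + ((b + 2 * a * t) * x + (2 * c + t * b)) ^+ 2) <->
  0 <= b ^+ 2 - 4 * a * c.
Proof.
move=> a0; split=> [h|D0 x]; last first.
  by rewrite addr_ge0 ?sqr_ge0// mulr_ge0 ?sqr_ge0// mulr_ge0.
rewrite leNgt; apply/negP => D_lt0.
have [m0|m0] := eqVneq (b + 2 * a * t) 0.
  (* Here [E] is constant, so [x] must be far enough from [t]: at [x = t + 1 + u] the sum is
     [3 D ((1 + u)^2 - u)], which is negative. *)
  pose u := (2 * c + t * b) ^+ 2 / (- 3 * (b ^+ 2 - 4 * a * c)).
  have u0 : 0 <= u by rewrite divr_ge0 ?sqr_ge0//; lra.
  have := h (t + 1 + u); rewrite m0 mul0r add0r.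
  have -> : (2 * c + t * b) ^+ 2 = u * (- 3 * (b ^+ 2 - 4 * a * c)).
    by rewrite /u; field; lra.
  have -> : 3 * (b ^+ 2 - 4 * a * c) * (t + 1 + u - t) ^+ 2 +
      u * (-3 * (b ^+ 2 - 4 * a * c)) =
      3 * (b ^+ 2 - 4 * a * c) * (1 + u + u ^+ 2) by ring.
  rewrite pmulr_lge0; first by lra.
  by have := sqr_ge0 u; lra.
(* The zero of [E]: only the term in [D] survives there. *)
pose x := - (2 * c + t * b) / (b + 2 * a * t).
have Ex : (b + 2 * a * t) * x + (2 * c + t * b) = 0 by rewrite /x; field.
have [xt|xt] := eqVneq x t; last first.
  have := h x; rewrite Ex expr0n addr0 pmulr_lge0; first by lra.
  by rewrite exprn_even_gt0//= subr_eq0.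
(* Since [E(t) = 2 Q(t)], now [Q(t) = 0], and [D = (b + 2 a t)^2 - 4 a Q(t)] is a square. *)
have : 0 <= (b + 2 * a * t) ^+ 2 by exact: sqr_ge0.
by move: Ex; rewrite xt; nra.
Qed.

Lemma concave_function_posP {R : realType} (f : R -> R) :
  concave_function (`]0, +oo[ : set R^o) f <->
  forall t x y : R, 0 <= t -> t <= 1 -> 0 < x -> 0 < y ->
    t * f x + (1 - t) * f y <= f (t * x + (1 - t) * y).
Proof.
split=> [h t x y t0 t1 x0 y0|h t x y].
  by apply: (h (Itv01 t0 t1)); rewrite inE /= in_itv /= andbT.
rewrite !inE /= !in_itv /= !andbT => x0 y0.
by apply: h.
Qed.

(** The exponent is 1 and the values are nonnegative, so the power is [P] itself, which is affine:
    equality holds. *)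
Lemma concave_linear {R : realType} (P : {poly R}) :
  (forall i : nat, 0 <= P`_i) -> size P = 2%N ->
  concave_function (`]0, +oo[ : set R^o) (fun x : R => P.[x] `^ 1%:R^-1).
Proof.
move=> P0 sP; apply/concave_function_posP => t x y t0 t1 x0 y0.
have hP z : P.[z] = P`_1 * z + P`_0.
  by rewrite horner_coef sP !big_ord_recl big_ord0 /= expr0 expr1; ring.
have t1' : 0 <= 1 - t by lra.
have tx : 0 <= t * x by rewrite mulr_ge0// ltW.
have ty : 0 <= (1 - t) * y by rewrite mulr_ge0// ltW.
have pos z : 0 <= z -> 0 <= P`_1 * z + P`_0.
  by move=> z0; rewrite addr_ge0// mulr_ge0.
rewrite invr1 !hP !powRr1 ?pos ?addr_ge0 ?(ltW x0) ?(ltW y0)//.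
by lra.
Qed.

Lemma concave_sqrt_quadratic {R : realType} (a b c : R) :
  0 <= a -> 0 <= b -> 0 <= c ->
  concave_function (`]0, +oo[ : set R^o)
    (fun x : R => (quadratic a b c).[x] `^ 2%:R^-1) <->
  0 <= b ^+ 2 - 4 * a * c.
Proof.
move=> a0 b0 c0; set P := quadratic a b c.
have P_ge0 x : 0 <= x -> 0 <= P.[x].
  by move=> x0; rewrite horner_quadratic !addr_ge0 ?mulr_ge0 ?sqr_ge0.
pose B x y := a * x * y + b * (x + y) / 2 + c.
have B_ge0 x y : 0 <= x -> 0 <= y -> 0 <= B x y.
  by move=> x0 y0; rewrite !addr_ge0 ?mulr_ge0 ?addr_ge0 ?invr_ge0.
have PB t x y : P.[t * x + (1 - t) * y] =
    t ^+ 2 * P.[x] + (1 - t) ^+ 2 * P.[y] + 2 * t * (1 - t) * B x y.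
  by rewrite !horner_quadratic /B; field.
have BE x y :
    B x y ^+ 2 - P.[x] * P.[y] = (b ^+ 2 - 4 * a * c) / 4 * (x - y) ^+ 2.
  by rewrite !horner_quadratic /B; field.
have sqrtB t x y : 0 <= t -> t <= 1 -> 0 < x -> 0 < y ->
  (t * P.[x] `^ 2^-1 + (1 - t) * P.[y] `^ 2^-1 <= P.[t * x + (1 - t) * y] `^ 2^-1)
    = (t * (1 - t) * Num.sqrt (P.[x] * P.[y]) <= t * (1 - t) * B x y).
  move=> t0 t1 /ltW x0 /ltW y0.
  have s0 : 0 <= 1 - t by lra.
  have z0 : 0 <= t * x + (1 - t) * y by rewrite addr_ge0 ?mulr_ge0.
  rewrite !powR12_sqrt ?P_ge0// sqrtrM ?P_ge0//.
  (* Both sides are nonnegative; after squaring, the terms [t^2 P(x)] and [(1 - t)^2 P(y)]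
     cancel. *)
  rewrite -[LHS]ler_sqr ?nnegrE ?addr_ge0 ?mulr_ge0 ?sqrtr_ge0// sqr_sqrtr ?P_ge0// PB.
  rewrite -{2}(sqr_sqrtr (P_ge0 _ x0)) -{2}(sqr_sqrtr (P_ge0 _ y0)).
  by apply/idP/idP; lra.
split=> [/concave_function_posP cv|D0].
  (* One midpoint test at two distinct positive points suffices, as
     [B(1, 2)^2 - P(1) P(2) = D / 4]. *)
  have : 2^-1 * (1 - 2^-1) * Num.sqrt (P.[1] * P.[2]) <= 2^-1 * (1 - 2^-1) * B 1 2.
    by rewrite -sqrtB; [apply: cv| | | |]; lra.
  rewrite ler_pM2l; last by lra.
  move=> le_sqrt; have := BE 1 2.
  have : P.[1] * P.[2] <= B 1 2 ^+ 2.
    rewrite -[leLHS]sqr_sqrtr ?mulr_ge0 ?P_ge0//.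
    by rewrite ler_sqr ?nnegrE ?sqrtr_ge0 ?B_ge0.
  by lra.
apply/concave_function_posP => t x y t0 t1 x0 y0; rewrite sqrtB//.
rewrite ler_wpM2l ?mulr_ge0//; first by lra.
(* Write [B] as [sqrt (B^2)], so that the comparison reduces to the sign of [D]. *)
rewrite -[leRHS]ger0_norm ?B_ge0 ?(ltW x0) ?(ltW y0)// -sqrtr_sqr ler_wsqrtr//.
by rewrite -subr_ge0 BE mulr_ge0 ?sqr_ge0 ?divr_ge0.
Qed.

(** A polynomial of odd degree over a real closed field has a root, and dividing by its linear
    factor leaves degree 2. *)
Lemma cubic_factor {R : rcfType} (P : {poly R}) : size P = 4%N ->
  exists a b c t : R, a != 0 /\ P = ('X - t%:P) * quadratic a b c.
Proof.
move=> sP; have [|t /factor_theorem[Q defP]] := @odd_poly_root _ P; first by rewrite sP.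
have sQ : size Q = 3%N.
  have Q0 : Q != 0 by apply: contra_eq_neq sP => Q0; rewrite defP Q0 mul0r size_poly0.
  by move: sP; rewrite defP size_Mmonic ?monicXsubC// size_XsubC addn2 => -[].
exists Q`_2, Q`_1, Q`_0, t; split; last by rewrite -size3_quadratic// mulrC.
by rewrite -[2%N]/(3.-1) -sQ -lead_coefE lead_coef_eq0 -size_poly_eq0 sQ.
Qed.

Theorem theorem2p4 (R : realType) (P : {poly R}) (n : nat)
    (hcoef : forall i : nat, 0 <= P`_i) (hn : (1 <= n)%N) (hdeg : size P = n.+1) :
  let P1 := real_rooted P in
  let P2 := forall x : R,
    P.[x] * P^`(2).[x] + (n%:R^-1 - 1) * P^`().[x] ^+ 2 <= 0 in
  let P3 := concave_function (`]0, +oo[ : set R^o)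
    (fun x : R => P.[x] `^ n%:R^-1) in
  ((n <= 2)%N -> (P1 <-> P2) /\ (P2 <-> P3)) /\
  (n = 3%N -> (P1 <-> P2)).
Proof.
move=> P1 P2 P3; split=> [n2|n3].
  case: n => [|[|[|n]]]// in hn hdeg P2 P3 n2 *.
    (* In degree 1 all three properties hold; in (P2) both [P''] and [1/n - 1] vanish. *)
    have p1 : P1 by exact: real_rooted_linear.
    have p2 : P2.
      move=> x; have -> : P^`(2) = 0.
        by apply/polyP => i; rewrite coef_derivn nth_default ?mul0rn ?coef0 ?hdeg.
      by rewrite horner0 mulr0 invr1 subrr mul0r addr0.
    have p3 : P3 by exact: concave_linear.
    by split.
  have a0 : P`_2 != 0.
    by rewrite -[2%N]/(3.-1) -hdeg -lead_coefE lead_coef_eq0 -size_poly_eq0 hdeg.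
  have defP := size3_quadratic P hdeg.
  move: a0 (hcoef 2) (hcoef 1) (hcoef 0) defP; rewrite {}/P1 {}/P2 {}/P3.
  move: (P`_2) (P`_1) (P`_0) => a b c a0 a_ge0 b_ge0 c_ge0 ->.
  (* In degree 2 each property amounts to [0 <= D]. *)
  rewrite (real_rooted_quadratic _ _ _ a0) (concave_sqrt_quadratic _ _ _ a_ge0 b_ge0 c_ge0).
  suff -> : (forall x, (quadratic a b c).[x] * (quadratic a b c)^`(2).[x] +
      (2%:R^-1 - 1) * (quadratic a b c)^`().[x] ^+ 2 <= 0) <->
      0 <= b ^+ 2 - 4 * a * c by [].
  (* The expression does not depend on [x], so evaluation at 0 recovers the sign of [D]. *)
  by split=> [/(_ 0)|D0 x]; rewrite quadratic_P2; lra.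
subst n; have [a [b [c [t [a0 defP]]]]] := cubic_factor P hdeg.
rewrite {}/P1 {}/P2 {P3} defP.
(* The factor [X - t] has only the real root [t], so only the quadratic factor matters. *)
transitivity (real_rooted (quadratic a b c)).
  rewrite real_rooted_mul; split=> [[]//|rr].
  by split=> //; exact: real_rooted_XsubC.
rewrite (real_rooted_quadratic _ _ _ a0) -(cubic_P2_disc a b c t a0).
by split=> h x; have := h x; rewrite cubic_P2; lra.
Qed.
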